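(* Let $O$ be a cyclic operad with multiplication over a commutative ring $\Bbbk$, let $\overline{\mathcal C}^*(O)$ be its normalized cochain complex with differential $d$, and $B$ the Connes normalized coboundary map. For $f\in\overline{\mathcal C}^m(O)$, $g\in\overline{\mathcal C}^n(O)$ put $$Z(f,g):=(-1)^{mn}\sum_{j=1}^m(-1)^{j(m+n-1)}\tau_{m+n-1}^{-j}\sigma_{m+n}(g\cup f)\in\overline{\mathcal C}^{m+n-1}(O)$$ and consider the bilinear map of degree $-2$, $H:\overline{\mathcal C}^m(O)\otimes\overline{\mathcal C}^n(O)\to\overline{\mathcal C}^{m+n-2}(O)$, $$H(f,g):=\sum_{1\le j\le p\le m-1}(-1)^{jm-j+(n-1)(p+1+m)}\,\tau_{m+n-2}^{-j}\sigma_{m+n-1}(f\circ_{p-j+1}g).$$ Then for any $f\in\overline{\mathcal C}^m(O)$ and $g\in\overline{\mathcal C}^n(O)$, $$(-1)^m\big(Z(f,g)-(Bf)\cup g\big)-f\overline{\circ}g=dH(f,g)+H(df,g)+(-1)^{m-1}H(f,dg).$$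
   Context: **Operads.** Operad means non-$\Sigma$ operad in $\Bbbk$-modules: modules $O(n)$, $n\in\mathbb N$ (including $n=0$), an element $id\in O(1)$, and structure maps $\gamma:O(n)\otimes O(i_1)\otimes\cdots\otimes O(i_n)\to O(i_1+\cdots+i_n)$ satisfying associativity and unit. For $f\in O(m)$, $g\in O(n)$, $1\le i\le m$, put $f\circ_ig:=\gamma(f;id,\dots,g,\dots,id)\in O(m+n-1)$ ($g$ in $i$-th place). An operad with multiplication is an operad with elements $\mu\in O(2)$, $e\in O(0)$ such that $\mu\circ_1\mu=\mu\circ_2\mu$ and $\mu\circ_1e=id=\mu\circ_2e$. A cyclic operad is an operad $O$ with linear maps $\tau_n:O(n)\to O(n)$, $n\in\mathbb N$, such that $\tau_n^{n+1}=\mathrm{id}$; for $m,n\ge1$, $\tau_{m+n-1}(f\circ_1g)=\tau_ng\circ_n\tau_mf$; and for $m\ge2$, $n\ge0$, $2\le i\le m$, $\tau_{m+n-1}(f\circ_ig)=\tau_mf\circ_{i-1}g$ (for all $f\in O(m)$, $g\in O(n)$). A cyclic operad with multiplication is an operad which is both an operad with multiplication and a cyclic operad, such that $\tau_2\mu=\mu$. **Notation.** For $f\in O(m)$, $g\in O(n)$: $f\cup g:=(\mu\circ_1f)\circ_{m+1}g\in O(m+n)$ and $f\overline{\circ}g:=(-1)^{(m-1)(n-1)}\sum_{i=1}^m(-1)^{(n-1)(i-1)}f\circ_ig\in O(m+n-1)$. Differential: for $f\in O(m)$, $df=\mu\circ_2f+\sum_{i=1}^m(-1)^if\circ_i\mu+(-1)^{m+1}\mu\circ_1f\in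 O(m+1)$. Codegeneracies: $\sigma_{i-1}:O(n)\to O(n-1)$, $\sigma_{i-1}f=f\circ_ie$ for $1\le i\le n$. Extra degeneracy: $\sigma_n:=\sigma_{n-1}\tau_n:O(n)\to O(n-1)$ for $n\ge1$. Normalized cochains: $\overline{\mathcal C}^n(O)=\{f\in O(n):\sigma_jf=0,\ 0\le j\le n-1\}$, with $\overline{\mathcal C}^{i}(O)=0$ for $i<0$; it is a subcomplex for $d$. Connes normalized coboundary: $B:=\sum_{i=0}^{n-1}(-1)^{i(n-1)}\tau_{n-1}^i\,\sigma_n:\overline{\mathcal C}^n(O)\to\overline{\mathcal C}^{n-1}(O)$ for $n\ge1$, and $B=0$ for $n=0$. Empty sums are $0$; in $H(df,g)$ and $H(f,dg)$ the formula for $H$ is applied with $m$ replaced by $m+1$, respectively $n$ replaced by $n+1$. *)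

(* Defs.v *)
From HB Require Import structures.
From mathcomp Require Import all_boot all_order all_algebra zify.

Set Implicit Arguments.
Unset Strict Implicit.
Unset Printing Implicit Defensive.

Import GRing.Theory.
Local Open Scope ring_scope.

(* [msign k z] is (-1)^z for an integer exponent z, since (-1)^z = (-1)^|z|. *)
Definition msign (k : comPzRingType) (z : int) : k := (-1) ^+ `|z|%N.

Definition gcast (k : comPzRingType) (V : nat -> lmodType k) (a b : nat)
  (eq_ab : a = b) (x : V a) : V b := ecast n (V n) eq_ab x.

Lemma sum_tagnat (n : nat) (a : 'I_n -> nat) (b : forall j, 'I_(a j) -> nat) :
  (\sum_(s < \sum_(j < n) a j) b (tagnat.sig1 s) (tagnat.sig2 s)
   = \sum_(j < n) \sum_(l < a j) b j l)%N.
Proof.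
rewrite (sig_big_dep xpredT (fun _ => xpredT) b) /=.
by rewrite (reindex _ tagnat.sig_bij_on).
Qed.

Lemma sum_ones (n : nat) : (\sum_(j < n) 1 = n)%N.
Proof. by rewrite sum_nat_const card_ord muln1. Qed.

Lemma sum_unary (n : nat) : (\sum_(j < 1) n = n)%N.
Proof. by rewrite big_ord1. Qed.

(* Non-Sigma operads in k-modules.  The structure map O(n) (x) O(a_1) (x) ...
   (x) O(a_n) -> O(a_1 + ... + a_n) is given as a multilinear map.  In the
   associativity axiom the a_1 + ... + a_n inputs are listed in the
   lexicographic order of the pairs (j, l), l < a_j: the s-th one is the pair
   (tagnat.sig1 s, tagnat.sig2 s). *)
Record operad (k : comPzRingType) := Operad {
  op_mod :> nat -> lmodType k;
  op_id : op_mod 1%N;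
  op_gamma : forall (n : nat) (a : 'I_n -> nat),
    op_mod n -> (forall j, op_mod (a j)) -> op_mod (\sum_(j < n) a j)%N;
  op_gamma_linearl : forall (n : nat) (a : 'I_n -> nat)
    (g : forall j, op_mod (a j)) (c : k) (x y : op_mod n),
    op_gamma (c *: x + y) g = c *: op_gamma x g + op_gamma y g;
  op_gamma_linearr : forall (n : nat) (a : 'I_n -> nat) (f : op_mod n)
    (g : forall j, op_mod (a j)) (j : 'I_n) (c : k) (x y : op_mod (a j)),
    op_gamma f (dfwith g (c *: x + y))
    = c *: op_gamma f (dfwith g x) + op_gamma f (dfwith g y);
  op_gammaA : forall (n : nat) (a : 'I_n -> nat) (b : forall j, 'I_(a j) -> nat)
    (f : op_mod n) (g : forall j, op_mod (a j))
    (h : forall j (l : 'I_(a j)), op_mod (b j l)),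
    gcast (sum_tagnat b)
      (op_gamma (op_gamma f g) (fun s => h (tagnat.sig1 s) (tagnat.sig2 s)))
    = op_gamma f (fun j => op_gamma (g j) (h j));
  op_gamma1l : forall (n : nat) (f : op_mod n),
    gcast (sum_unary n) (op_gamma op_id (fun _ : 'I_1 => f)) = f;
  op_gamma1r : forall (n : nat) (f : op_mod n),
    gcast (sum_ones n) (op_gamma f (fun _ : 'I_n => op_id)) = f
}.

Section PartialComposition.
Variables (k : comPzRingType) (O : operad k).

Definition slot_arity (m n : nat) (s : 'I_m) (j : 'I_m) : nat :=
  if j == s then n else 1%N.

Definition slot_inputs (m n : nat) (s : 'I_m) (g : O n) (j : 'I_m) :
    O (slot_arity n s j) :=
  match j == s as b return O (if b then n else 1%N) with
  | true => g
  | false => op_id O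
  end.

Lemma sum_slot_arity (m n : nat) (s : 'I_m) :
  (\sum_(j < m) slot_arity n s j = (m + n).-1)%N.
Proof.
rewrite (bigD1 s) //= {1}/slot_arity eqxx.
rewrite (eq_bigr (fun=> 1%N)) => [|j /negPf]; last by rewrite /slot_arity => ->.
rewrite sum1_card cardC1 card_ord.
by case: m s => [[]|m _] //=; rewrite addnC.
Qed.

(* f o_i g for 1 <= i <= m, with slots numbered from 1; the value for other i
   is never used. *)
Definition circ (m n : nat) (f : O m) (i : nat) (g : O n) : O (m + n).-1 :=
  if [pick s : 'I_m | s.+1 == i] is Some s
  then gcast (sum_slot_arity n s) (op_gamma f (slot_inputs s g))
  else 0.

End PartialComposition.

(* (2 + m).-1 and m.+1 are convertible, so the composites mu o_1 f and mu o_2 f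
   need no cast when f : O m. *)
Record multiplication (k : comPzRingType) (O : operad k) := Multiplication {
  mult_mu : O 2%N;
  mult_e : O 0%N;
  mult_muA : circ mult_mu 1 mult_mu = circ mult_mu 2 mult_mu;
  mult_mu1l : circ mult_mu 1 mult_e = op_id O;
  mult_mu1r : circ mult_mu 2 mult_e = op_id O
}.

Record cyclic_structure (k : comPzRingType) (O : operad k) := CyclicStructure {
  cyc_tau : forall n : nat, {linear O n -> O n};
  cyc_tau_order : forall (n : nat) (f : O n), iter n.+1 (cyc_tau n) f = f;
  cyc_tau_circ1 : forall (m n : nat) (f : O m) (g : O n),
    (1 <= m)%N -> (1 <= n)%N ->
    cyc_tau _ (circ f 1 g)
    = gcast (congr1 predn (addnC n m)) (circ (cyc_tau n g) n (cyc_tau m f));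
  cyc_tau_circ : forall (m n : nat) (f : O m) (g : O n) (i : nat),
    (2 <= i <= m)%N ->
    cyc_tau _ (circ f i g) = circ (cyc_tau m f) i.-1 g
}.

Record cyclic_mult_operad (k : comPzRingType) := CyclicMultOperad {
  cm_operad :> operad k;
  cm_mult : multiplication cm_operad;
  cm_cyc : cyclic_structure cm_operad;
  cm_tau_mu : cyc_tau cm_cyc 2 (mult_mu cm_mult) = mult_mu cm_mult
}.

(* Formulas on the modules O(n), n : nat.  Whenever a target degree is
   negative, the truncated nat degree is a dummy and the value is an empty sum;
   these cases are moved to the zero module below. *)
Section Formulas.
Variables (k : comPzRingType) (O : cyclic_mult_operad k).
Local Notation mu := (mult_mu (cm_mult O)).
Local Notation e := (mult_e (cm_mult O)).
Local Notation sg := (msign k).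

Definition tau (n : nat) : {linear O n -> O n} := cyc_tau (cm_cyc O) n.

(* The inverse of tau n, as tau n has order dividing n.+1. *)
Definition tauV (n : nat) : O n -> O n := iter n (tau n).

Lemma tauK (n : nat) : cancel (tau n) (@tauV n).
Proof. by move=> f; rewrite /tauV -iterSr; exact: cyc_tau_order. Qed.

Lemma tauVK (n : nat) : cancel (@tauV n) (tau n).
Proof. by move=> f; rewrite /tauV -iterS; exact: cyc_tau_order. Qed.

Definition op_cup (m n : nat) (f : O m) (g : O n) : O (m + n)%N :=
  circ (circ mu 1 f) m.+1 g.

Definition op_ocirc (m n : nat) (f : O m) (g : O n) : O (m + n).-1 :=
  sg ((m%:Z - 1) * (n%:Z - 1)) *:
    \sum_(1 <= i < m.+1) sg ((n%:Z - 1) * (i%:Z - 1)) *: circ f i g.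

Definition op_diff (m : nat) (f : O m) : O m.+1 :=
  circ mu 2 f
  + \sum_(1 <= i < m.+1) sg i%:Z *: gcast (congr1 predn (addnC m 2)) (circ f i mu)
  + sg (m%:Z + 1) *: (circ mu 1 f : O m.+1).

(* sigma_j, for 0 <= j <= n - 1 *)
Definition codegen (n j : nat) (f : O n) : O n.-1 :=
  gcast (congr1 predn (addn0 n)) (circ f j.+1 e).

(* the extra degeneracy sigma_n, for n >= 1 *)
Definition extra_degen (n : nat) (f : O n) : O n.-1 :=
  codegen n.-1 (tau n f).

Definition op_connes (n : nat) (f : O n) : O n.-1 :=
  \sum_(0 <= i < n) sg (i%:Z * (n%:Z - 1)) *: iter i (tau n.-1) (extra_degen f).

Definition op_Z (m n : nat) (f : O m) (g : O n) : O (m + n).-1 :=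
  sg (m%:Z * n%:Z) *:
    \sum_(1 <= j < m.+1) sg (j%:Z * (m%:Z + n%:Z - 1)) *:
      iter j (@tauV _) (extra_degen (gcast (addnC n m) (op_cup g f))).

Definition op_H (m n : nat) (f : O m) (g : O n) : O (m + n).-2 :=
  \sum_(1 <= p < m) \sum_(1 <= j < p.+1)
    sg (j%:Z * m%:Z - j%:Z + (n%:Z - 1) * (p%:Z + 1 + m%:Z)) *:
      iter j (@tauV _) (extra_degen (circ f (p - j + 1) g)).

(* Cochains in integer degrees: C^i = O(i) for i >= 0, and C^i = 0 for i < 0. *)
Definition cochain (i : int) : lmodType k :=
  match i with
  | Posz n => O n
  | Negz _ => 'rV[k]_0
  end.

Definition ccast (i j : int) (eq_ij : i = j) (x : cochain i) : cochain j :=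
  ecast a (cochain a) eq_ij x.

(* Reads x : O a as a cochain of degree i, where a is i or i is negative. *)
Definition to_cochain (a : nat) (i : int) : (0 <= i -> a = i :> int) ->
    O a -> cochain i :=
  match i with
  | Posz n => fun deg x => ccast (deg isT) (x : cochain a)
  | Negz _ => fun _ _ => 0
  end.

Definition normalized (i : int) : cochain i -> Prop :=
  match i with
  | Posz n => fun f : O n => forall j : nat, (j < n)%N -> codegen j f = 0
  | Negz _ => fun _ => True
  end.

Lemma deg_diff (m : nat) : 0 <= m%:Z + 1 -> m.+1 = m%:Z + 1 :> int.
Proof. by move=> _; lia. Qed.

Lemma deg_connes (n : nat) : 0 <= n%:Z - 1 -> n.-1 = n%:Z - 1 :> int.
Proof. by case: n => [|n] //=; lia. Qed.

Lemma deg_cup (m n : nat) : 0 <= m%:Z + n%:Z -> (m + n)%N = m%:Z + n%:Z :> int.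
Proof. by []. Qed.

Lemma deg_pred (m n : nat) :
  0 <= m%:Z + n%:Z - 1 -> (m + n).-1 = m%:Z + n%:Z - 1 :> int.
Proof. by rewrite -PoszD; exact: deg_connes. Qed.

Lemma deg_pred2 (m n : nat) :
  0 <= m%:Z + n%:Z - 2 -> (m + n).-2 = m%:Z + n%:Z - 2 :> int.
Proof. by rewrite -PoszD; case: (m + n)%N => [|[|p]] //=; lia. Qed.

Definition diff (i : int) : cochain i -> cochain (i + 1) :=
  match i with
  | Posz m => fun f => to_cochain (@deg_diff m) (@op_diff m f)
  | Negz _ => fun _ => 0
  end.

Definition connes (i : int) : cochain i -> cochain (i - 1) :=
  match i with
  | Posz n => fun f => to_cochain (@deg_connes n) (@op_connes n f)
  | Negz _ => fun _ => 0
  end.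

Definition cup (i j : int) : cochain i -> cochain j -> cochain (i + j) :=
  match i, j with
  | Posz m, Posz n =>
      fun f g => to_cochain (@deg_cup m n) (@op_cup m n f g)
  | _, _ => fun _ _ => 0
  end.

Definition ocirc (i j : int) : cochain i -> cochain j -> cochain (i + j - 1) :=
  match i, j with
  | Posz m, Posz n =>
      fun f g => to_cochain (@deg_pred m n) (@op_ocirc m n f g)
  | _, _ => fun _ _ => 0
  end.

Definition Zmap (i j : int) : cochain i -> cochain j -> cochain (i + j - 1) :=
  match i, j with
  | Posz m, Posz n =>
      fun f g => to_cochain (@deg_pred m n) (@op_Z m n f g)
  | _, _ => fun _ _ => 0
  end.

Definition Hmap (i j : int) : cochain i -> cochain j -> cochain (i + j - 2) :=
  match i, j with
  | Posz m, Posz n =>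
      fun f g => to_cochain (@deg_pred2 m n) (@op_H m n f g)
  | _, _ => fun _ _ => 0
  end.

End Formulas.

Lemma deg_cup_connes (m n : int) : m - 1 + n = m + n - 1.
Proof. lia. Qed.

Lemma deg_diff_H (m n : int) : m + n - 2 + 1 = m + n - 1.
Proof. lia. Qed.

Lemma deg_H_diffl (m n : int) : m + 1 + n - 2 = m + n - 1.
Proof. lia. Qed.

Lemma deg_H_diffr (m n : int) : m + (n + 1) - 2 = m + n - 1.
Proof. lia. Qed.

(* Main.v *)
Require Import Defs.
From HB Require Import structures.
From mathcomp Require Import all_boot all_order all_algebra zify ssrAC.
From Stdlib Require Import FunctionalExtensionality.

(** Think of [f] in [O m] as an operation with [m + 1] cyclically ordered legs,
leg 0 being the output; [tau] moves the output to the next leg and [x o_i g]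
glues leg 0 of [g] to leg [i] of [x].  Plugging the unit [e] into leg 0 of [f]
and taking another leg as output gives the elements
[x_j = tau^-j (extra_degen f) = (tau^-j f) o_j e] of [O (m - 1)], for
[1 <= j <= m] ([iter_tauV_extra_degen]).  Both [B] and [H] are made of
them.  Writing [P_q f] for the truncated sum of [(-1)^(j(m-1)) x_j] over
[j <= q] ([partial_connes]),

- [B f = P_m f] ([op_connesE]);
- [H(f,g)] is the signed sum of the [(P_p f) o_p g] for [1 <= p < m], because
  [tau^-j] of the extra degeneracy of [f o_(p-j+1) g] is [x_j o_p g] ([op_HE]);
- [Z(f,g)] is the signed sum of the [(tau^-j f) o_j g] ([op_ZE]).

Two identities then give the result.  The first one is the Leibniz rule for a
partial composition ([op_diff_pcirc]): with [d_i] the faces whose alternating sum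
is [d], and up to signs,
[[
  d(x o_p g) = x o_p dg + (sum_(i <= p) d_i x) o_(p+1) g
                        + (sum_(i >= p) d_i x) o_p g .
]]
In [d H(f,g)] the terms with [dg] cancel against [H(f,dg)], and the coefficient
of [_ o_q g] becomes a lower sum of faces of [P_(q-1) f] plus an upper sum of
faces of [P_q f].  The second one ([partial_connes_homotopy]) is a truncated form
of [Bd + dB = 0], and says what has to be added to [P_q (df)]:
[[
  P_q (df) + (sum_(i < q) d_i (P_(q-1) f)) + (sum_(i >= q) d_i (P_q f))
    = +- tau^-q f - f  (the sums with the signs (-1)^i).
]]
It follows from the cocyclic identities by induction on [q].  Composing with [g]
in slot [q] and summing over [q], the terms [tau^-q f o_q g] add up to [Z(f,g)],
the terms [f o_q g] to the pre-Lie product, and [(Bf) cup g] is the term for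
[q = m] of the upper sum, which [d H(f,g)] does not contain since [p < m].

The operad axioms are stated with the full composition, whose target degree is a
sum.  They are first turned into the axioms for partial compositions, which are
here given a free target degree ([pcirc]), so that no degree cast appears in the
computations. *)

Set Implicit Arguments.
Unset Strict Implicit.
Unset Printing Implicit Defensive.

Import GRing.Theory.
Local Open Scope ring_scope.

(** * Signs *)

Section Signs.
Variable R : comPzRingType.

Lemma sign_congr a b : odd a = odd b -> (-1) ^+ a = (-1) ^+ b :> R.
Proof. by move=> E; rewrite -signr_odd E signr_odd. Qed.

Lemma sign_opp a b : odd a = ~~ odd b -> (-1) ^+ a = - (-1) ^+ b :> R.
Proof. by move=> E; rewrite (@sign_congr a b.+1) ?exprS ?mulN1r. Qed.

Lemma msignE (z : int) a : odd `|z|%N = odd a -> msign R z = (-1) ^+ a.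
Proof. exact: sign_congr. Qed.

Lemma odd_abszD (x y : int) : odd `|(x + y)%R|%N = odd `|x|%N (+) odd `|y|%N.
Proof. lia. Qed.

Lemma odd_abszN (x : int) : odd `|(- x)%R|%N = odd `|x|%N.
Proof. by rewrite abszN. Qed.

Lemma odd_abszM (x y : int) : odd `|(x * y)%R|%N = odd `|x|%N && odd `|y|%N.
Proof. by rewrite abszM oddM. Qed.

End Signs.

Ltac parity :=
  rewrite ?(oddD, oddM, oddS) /=;
  repeat match goal with |- context [odd ?n] => case: (odd n) end; reflexivity.
Ltac zparity := rewrite ?(odd_abszD, odd_abszN, odd_abszM) ?absz_nat /=; parity.

(** * Full compositions of lists *)

Section Casts.
Variables (k : comPzRingType) (V : nat -> lmodType k).

(** An equality between packed elements is an equality up to a degree cast, so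
that identities between elements of different-looking degrees can be stated. *)
Definition pack (n : nat) (x : V n) : {n : nat & V n} := existT (fun n => V n) n x.

Lemma pack_inj n : injective (@pack n).
Proof. by move=> x y; exact: (@eq_from_Tagged _ (fun n => V n)). Qed.

Lemma pack_cast a b (e : a = b) (x : V a) : pack (gcast e x) = pack x.
Proof. by case: b / e. Qed.

Lemma gcast_linear a b (e : a = b) : linear (@gcast k V a b e).
Proof. by case: b / e. Qed.

HB.instance Definition _ a b (e : a = b) :=
  GRing.isLinear.Build k (V a) (V b) *:%R (@gcast k V a b e) (gcast_linear e).

End Casts.

Section ListComposition.
Variables (k : comPzRingType) (O : operad k).

Definition pack_id : {n : nat & O n} := pack (op_id O).

(** The inputs come as a list so that the lexicographic renumbering of inputs in
the associativity axiom becomes the concatenation of lists.  The identity is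
only a default value for [nth]: the length of [gs] is meant to be the arity. *)
Definition gamma_seq (F : {n : nat & O n}) (gs : seq {n : nat & O n}) :
    {n : nat & O n} :=
  pack (op_gamma (tagged F) (fun j : 'I_(tag F) => tagged (nth pack_id gs j))).

(** As the arities [a] and [a'] are only propositionally equal, the inputs are
compared as functions to packed elements, of which the composite is a function. *)
Lemma op_gamma_ext n (a a' : 'I_n -> nat) (f : O n)
    (g : forall j, O (a j)) (g' : forall j, O (a' j)) :
  (forall j, pack (g j) = pack (g' j)) -> pack (op_gamma f g) = pack (op_gamma f g').
Proof.
move=> eqg; have {}eqg := functional_extensionality _ _ eqg.
pose G (h : 'I_n -> {n : nat & O n}) := pack (op_gamma f (fun j => tagged (h j))).
exact: (congr1 G eqg).
Qed.

(** The ordinal sum numbers its pairs as [flatten] numbers the items of a list of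
lists. *)
Lemma nth_flatten_sig (T : Type) (x0 : T) (n : nat) (a : 'I_n -> nat)
    (tss : seq (seq T)) (s : 'I_(\sum_(j < n) a j)%N) :
    size tss = n -> (forall j : 'I_n, size (nth [::] tss j) = a j) ->
  nth x0 (flatten tss) s
  = nth x0 (nth [::] tss (tagnat.sig1 s)) (tagnat.sig2 s).
Proof.
move=> sz sza; set i := tagnat.sig1 s; set l := tagnat.sig2 s.
have sh j : (j < n)%N -> nth 0%N (shape tss) j = size (nth [::] tss j).
  by move=> ltj; rewrite (nth_map [::]) ?sz.
have Es : s = flatten_index (shape tss) i l :> nat.
  rewrite [LHS]tagnat.rect /flatten_index; congr (_ + _)%N.
  rewrite -/i; rewrite sumnE (big_nth 0%N) big_mkord size_take size_map sz ltn_ord.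
  rewrite (big_ord_widen n (nth 0%N (take i (shape tss)))); last exact/ltnW.
  by apply: eq_bigr => j ltj; rewrite nth_take // sh // sza.
have ltl : (l < nth 0%N (shape tss) i)%N by rewrite sh // sza.
by rewrite Es nth_flatten flatten_indexKl // flatten_indexKr.
Qed.

Lemma gamma_seqA F gs hss : size gs = tag F -> shape hss = [seq tag g | g <- gs] ->
  gamma_seq (gamma_seq F gs) (flatten hss)
  = gamma_seq F [seq gamma_seq gh.1 gh.2 | gh <- zip gs hss].
Proof.
case: F => n f /= szg shh.
have szh : size hss = n by rewrite -szg -[RHS](size_map tag) -shh size_map.
pose a (j : 'I_n) := tag (nth pack_id gs j).
have sza (j : 'I_n) : size (nth [::] hss j) = a j.
  rewrite -(nth_map [::] 0%N size) ?szh // [map _ _]shh.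
  by rewrite (nth_map pack_id) ?szg.
pose h (j : 'I_n) (l : 'I_(a j)) := tagged (nth pack_id (nth [::] hss j) l).
have := op_gammaA f (fun j : 'I_n => tagged (nth pack_id gs j)) h.
move/(congr1 (@pack _ _ _)); rewrite pack_cast => E.
transitivity (pack (op_gamma f (fun j => op_gamma (tagged (nth pack_id gs j)) (h j)))).
  rewrite -E; apply: op_gamma_ext => s /=.
  by rewrite (@nth_flatten_sig _ pack_id n a).
apply: op_gamma_ext => j /=.
rewrite (nth_map (pack_id, [::])) ?size_zip ?szg ?szh ?minnn //=.
by rewrite nth_zip ?szg ?szh //= /gamma_seq /pack; case: (nth _ _ _).
Qed.

Lemma gamma_seq1l F : gamma_seq pack_id [:: F] = F.
Proof.
have := op_gamma1l (tagged F).
move/(congr1 (@pack _ _ _)); rewrite pack_cast => E.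
transitivity (pack (tagged F)); last by case: F {E}.
by rewrite -E; apply: op_gamma_ext => j /=; rewrite ord1 /=; case: F {E}.
Qed.

Lemma gamma_seq1r F : gamma_seq F (nseq (tag F) pack_id) = F.
Proof.
have := op_gamma1r (tagged F).
move/(congr1 (@pack _ _ _)); rewrite pack_cast => E.
transitivity (pack (tagged F)); last by case: F {E}.
by rewrite -E; apply: op_gamma_ext => j /=; rewrite nth_nseq ltn_ord.
Qed.

Definition slot_seq (m i : nat) (G : {n : nat & O n}) : seq {n : nat & O n} :=
  nseq i.-1 pack_id ++ G :: nseq (m - i) pack_id.

Lemma pack_circ m n (f : O m) i (g : O n) : (1 <= i <= m)%N ->
  pack (circ f i g) = gamma_seq (pack f) (slot_seq m i (pack g)).
Proof.
move=> /andP[i_gt0 lei]; rewrite /circ; case: pickP => [s /eqP Es|]; last first.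
  have lt : (i.-1 < m)%N by lia.
  by move/(_ (Ordinal lt)); rewrite /= prednK ?eqxx.
rewrite pack_cast; apply: op_gamma_ext => j /=.
rewrite /slot_seq nth_cat size_nseq -{i i_gt0 lei}Es /=.
rewrite /slot_arity /slot_inputs; case: eqP => [->|/eqP nej].
  by rewrite ltnn subnn.
have {}nej : (j != s :> nat) by [].
case: ltnP => ljs; first by rewrite nth_nseq ljs.
have -> : (j - s = (j - s).-1.+1)%N by lia.
by rewrite /= nth_nseq; case: ifP => //; lia.
Qed.

End ListComposition.

(** * Partial compositions *)

Section PartialCompositions.
Variables (k : comPzRingType) (O : operad k).

(** The target degree [p] is free, and the value for [p <> (m + n).-1] is junk:
the degrees of two iterated composites need not be syntactically equal. *)
Definition pcirc (m n p : nat) (f : O m) (i : nat) (g : O n) : O p :=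
  if @eqP _ (m + n).-1 p is ReflectT e then gcast e (circ f i g) else 0.

Lemma pcircE m n p (e : (m + n).-1 = p) (f : O m) i (g : O n) :
  gcast e (circ f i g) = pcirc p f i g.
Proof.
by rewrite /pcirc; case: eqP => // e'; rewrite (eq_irrelevance e' e).
Qed.

Lemma pcirc_cast m n p q (e : p = q) (f : O m) i (g : O n) :
  gcast e (pcirc p f i g) = pcirc q f i g.
Proof. by case: q / e. Qed.

Lemma pack_pcirc m n p (f : O m) i (g : O n) :
    (1 <= i <= m)%N -> (m + n = p.+1)%N ->
  pack (pcirc p f i g) = gamma_seq (pack f) (slot_seq m i (pack g)).
Proof.
move=> lei e; have {}e : (m + n).-1 = p by rewrite e.
by rewrite -(pcircE e) pack_cast pack_circ.
Qed.

Lemma flatten_nseq1 (T : Type) a (x : T) : flatten (nseq a [:: x]) = nseq a x.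
Proof. by elim: a => //= a ->. Qed.

Lemma zip_nseq (S T : Type) a (x : S) (y : T) :
  zip (nseq a x) (nseq a y) = nseq a (x, y).
Proof. by elim: a => //= a ->. Qed.

(** Nested compositions: both sides fill slot [i] of [f] with [g o_l h].  In list
form, the inputs of [f o_i g] are split according to the slots of [f], and the
associativity of full compositions applies. *)
Lemma pcircA m n p q r s (f : O m) (g : O n) (h : O p) i j l :
    (m + n = q.+1)%N -> (n + p = r.+1)%N -> (q + p = s.+1)%N ->
    (1 <= i <= m)%N -> (1 <= l <= n)%N -> (j = i + l.-1)%N ->
  pcirc s (pcirc q f i g) j h = pcirc s f i (pcirc r g l h).
Proof.
move=> eq_q eq_r eq_s lei lel ->; apply: pack_inj.
rewrite !pack_pcirc //; try lia.
pose hss := nseq i.-1 [:: pack_id O] ++ slot_seq n l (pack h) :: nseq (m - i) [:: pack_id O].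
have -> : slot_seq q (i + l.-1) (pack h) = flatten hss.
  rewrite flatten_cat /= !flatten_nseq1 /slot_seq -catA /= catA.
  by rewrite -!nseqD; congr (nseq _ _ ++ _ :: nseq _ _); lia.
rewrite gamma_seqA /hss ?size_cat /= ?size_nseq; first last.
- rewrite /shape /slot_seq !map_cat /= !map_nseq /= size_cat /= !size_nseq.
  by congr (_ ++ _ :: _); lia.
- lia.
rewrite /slot_seq zip_cat ?size_nseq //= !zip_nseq map_cat /= !map_nseq /=.
by rewrite gamma_seq1l.
Qed.

(** Disjoint compositions: both sides are the full composition of [f] with [g] in
slot [i], [h] in slot [j] and identities elsewhere. *)
Lemma pcircC m n p q r s (f : O m) (g : O n) (h : O p) i j l :
    (m + n = q.+1)%N -> (m + p = r.+1)%N -> (q + p = s.+1)%N ->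
    (1 <= i < j)%N -> (j <= m)%N -> (l = j.-1 + n)%N ->
  pcirc s (pcirc q f i g) l h = pcirc s (pcirc r f j h) i g.
Proof.
move=> eq_q eq_r eq_s lei lej ->; apply: pack_inj.
rewrite !pack_pcirc //; try lia.
transitivity (gamma_seq (pack f) (nseq i.-1 (pack_id O) ++ pack g ::
  (nseq (j - i).-1 (pack_id O) ++ pack h :: nseq (m - j) (pack_id O)))).
  pose hss := nseq i.-1 [:: pack_id O] ++ nseq n (pack_id O) ::
    (nseq (j - i).-1 [:: pack_id O] ++ [:: pack h] :: nseq (m - j) [:: pack_id O]).
  have -> : slot_seq q (j.-1 + n) (pack h) = flatten hss.
    rewrite !(flatten_cat, flatten_nseq1) /= !(flatten_cat, flatten_nseq1) /=.
    rewrite /slot_seq flatten_nseq1 !catA -!nseqD.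
    by congr (nseq _ _ ++ _ :: nseq _ _); lia.
  have E : (m - i = (j - i).-1 + (m - j).+1)%N by lia.
  rewrite gamma_seqA /hss /slot_seq ?E ?nseqD /= ?size_cat /= ?size_cat /= ?size_nseq; first last.
  - by rewrite /shape; do !rewrite !(map_cat, map_nseq) /=; rewrite size_nseq.
  - lia.
  rewrite !zip_cat ?size_nseq //= ?zip_cat ?size_nseq //= !zip_nseq.
  by do !rewrite !(map_cat, map_nseq) /=; rewrite !gamma_seq1l (@gamma_seq1r _ _ (pack g)).
pose hss := nseq i.-1 [:: pack_id O] ++ [:: pack g] ::
    (nseq (j - i).-1 [:: pack_id O] ++ nseq p (pack_id O) :: nseq (m - j) [:: pack_id O]).
have -> : slot_seq r i (pack g) = flatten hss.
  rewrite !(flatten_cat, flatten_nseq1) /= !(flatten_cat, flatten_nseq1) /=.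
  rewrite /slot_seq flatten_nseq1 -!nseqD.
  by congr (nseq _ _ ++ _ :: nseq _ _); lia.
have E : (j.-1 = i.-1 + (j - i).-1.+1)%N by lia.
rewrite gamma_seqA /hss /slot_seq ?E ?nseqD -?catA /= ?size_cat /= ?size_cat /=
  ?size_nseq; first last.
- by rewrite /shape; do !rewrite !(map_cat, map_nseq) /=; rewrite size_nseq.
- lia.
rewrite !zip_cat ?size_nseq //= ?zip_cat ?size_nseq //= !zip_nseq.
by do !rewrite !(map_cat, map_nseq) /=; rewrite !gamma_seq1l (@gamma_seq1r _ _ (pack h)).
Qed.

Lemma pcirc_idl m (f : O m) : pcirc m (op_id O) 1 f = f.
Proof. by apply: pack_inj; rewrite pack_pcirc //= gamma_seq1l. Qed.

Lemma pcirc_idr m (f : O m) i : (1 <= i <= m)%N -> pcirc m f i (op_id O) = f.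
Proof.
move=> lei; apply: pack_inj; rewrite pack_pcirc ?addn1 //.
rewrite -[RHS]gamma_seq1r /slot_seq -/(pack_id O).
rewrite -[pack_id O :: nseq _ _]/(nseq (m - i).+1 _) -nseqD.
by congr (gamma_seq _ (nseq _ _)) => /=; lia.
Qed.

Lemma pcirc_linearl m n p i (g : O n) : linear (fun f : O m => pcirc p f i g).
Proof.
move=> c x y; rewrite /pcirc; case: eqP => [e|_]; last by rewrite scaler0 addr0.
rewrite /circ; case: pickP => [s _|_]; last by rewrite !linear0 addr0.
by rewrite op_gamma_linearl !linearP.
Qed.

Lemma pcirc_linearr m n p (f : O m) i : linear (fun g : O n => pcirc p f i g).
Proof.
move=> c x y; rewrite /pcirc; case: eqP => [e|_]; last by rewrite scaler0 addr0.
rewrite /circ; case: pickP => [s _|_]; last by rewrite !linear0 addr0.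
have es : n = slot_arity n s s by rewrite /slot_arity eqxx.
have slotE (z : O n) : slot_inputs s z = dfwith (slot_inputs s 0) (gcast es z).
  apply: functional_extensionality_dep => j; case: dfwithP => [|j' ns].
    rewrite /slot_inputs; move: es (eqxx s); rewrite /slot_arity.
    by case: (s == s) => // es _; rewrite (eq_irrelevance es (erefl n)).
  by rewrite /slot_inputs /slot_arity eq_sym (negPf ns).
by rewrite (slotE (c *: x + y)) (slotE x) (slotE y) linearP op_gamma_linearr !linearP.
Qed.

End PartialCompositions.

Section Bilinearity.
Variables (k : comPzRingType) (O : operad k).

HB.instance Definition _ m n p (f : O m) i :=
  GRing.isLinear.Build k (O n) (O p) *:%R (pcirc p f i)
    (@pcirc_linearr k O m n p f i).

(** The argument [f] comes last, so that linearity in [f] can be declared. *)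
Definition pcircl m n p i (g : O n) (f : O m) : O p := pcirc p f i g.

HB.instance Definition _ m n p i (g : O n) :=
  GRing.isLinear.Build k (O m) (O p) *:%R (pcircl p i g)
    (@pcirc_linearl k O m n p i g).

Lemma pcirc0l m n p i (g : O n) : pcirc p (0 : O m) i g = 0.
Proof. exact: (linear0 (pcircl p i g)). Qed.

End Bilinearity.

(** * Cyclic rotation of partial compositions *)

Section Cyclic.
Variables (k : comPzRingType) (O : cyclic_mult_operad k).
Local Notation mu := (mult_mu (cm_mult O)).
Local Notation e := (mult_e (cm_mult O)).

Lemma tau_order n (f : O n) : iter n.+1 (tau O n) f = f.
Proof. exact: cyc_tau_order. Qed.

Lemma tau_pcirc m n p (f : O m) i (g : O n) :
    (2 <= i <= m)%N -> (m + n = p.+1)%N ->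
  tau O _ (pcirc p f i g) = pcirc p (tau O _ f) i.-1 g.
Proof.
move=> lei E; have {}E : (m + n).-1 = p by rewrite E.
by case: p / E; rewrite -!(pcircE erefl); apply: cyc_tau_circ.
Qed.

Lemma tau_pcirc1 m n p (f : O m) (g : O n) :
    (0 < m)%N -> (0 < n)%N -> (m + n = p.+1)%N ->
  tau O _ (pcirc p f 1 g) = pcirc p (tau O _ g) n (tau O _ f).
Proof.
move=> m_gt0 n_gt0 E; have {}E : (m + n).-1 = p by rewrite E.
case: p / E; rewrite -(pcircE erefl) -(pcircE (congr1 predn (addnC n m))).
exact: cyc_tau_circ1.
Qed.

Lemma iter_tau_pcirc m n p (f : O m) i j (g : O n) :
    (0 < i)%N -> (i + j <= m)%N -> (m + n = p.+1)%N ->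
  iter j (tau O _) (pcirc p f (i + j) g) = pcirc p (iter j (tau O _) f) i g.
Proof.
move=> i_gt0 + E; elim: j i i_gt0 => [|j IHj] i i_gt0 leij; first by rewrite addn0.
rewrite iterS addnS -addSn IHj ?tau_pcirc //; lia.
Qed.

(** The rotation axiom for slot 1 does not cover nullary [g].  That case follows
from the axiom for the slots [i >= 2]: if [f = tau^m w], then
[f o_1 g = tau^m (w o_(m+1) g)], and [tau] has order [m + 1] on [O m]. *)
Lemma tau_pcirc1_nullary m (f : O m.+1) (g : O 0%N) :
  tau O _ (pcirc m f 1 g) = pcirc m (tau O _ (tau O _ f)) m.+1 g.
Proof.
(* [w = tau^2 f], as [tau] has order [m + 2] on [O m.+1] *)
have E : iter m (tau O m.+1) (tau O _ (tau O _ f)) = f by rewrite -!iterSr tau_order.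
by rewrite -{1}E -iter_tau_pcirc ?addn0 // -iterS tau_order.
Qed.

HB.instance Definition _ n := GRing.isLinear.Build k (O n) (O n) *:%R (@tauV k O n)
  (can2_linear (@tauK k O n) (@tauVK k O n)).

(** * Faces, codegeneracies and rotation *)

Lemma codegen_pcirc n j (f : O n) : codegen j f = pcirc n.-1 f j.+1 e.
Proof. by rewrite /codegen (pcircE (congr1 predn (addn0 n))). Qed.

Lemma codegenE m j (f : O m.+1) : codegen j f = pcirc m f j.+1 e.
Proof. exact: codegen_pcirc. Qed.

Lemma codegen_linear n j : linear (@codegen k O n j).
Proof. by move=> c x y; rewrite !codegen_pcirc pcirc_linearl. Qed.

HB.instance Definition _ n j := GRing.isLinear.Build k (O n) (O n.-1) *:%R
  (@codegen k O n j) (@codegen_linear n j).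

(** The cofaces of the cosimplicial module of [O], whose alternating sum is the
differential. *)
Definition face m (i : nat) (x : O m) : O m.+1 :=
  if i == 0%N then pcirc m.+1 mu 2 x
  else if i == m.+1 then pcirc m.+1 mu 1 x else pcirc m.+1 x i mu.

Lemma face0 m (x : O m) : face 0 x = pcirc m.+1 mu 2 x.
Proof. by []. Qed.

Lemma face_last m (x : O m) : face m.+1 x = pcirc m.+1 mu 1 x.
Proof. by rewrite /face eqxx. Qed.

Lemma face_inner m i (x : O m) :
  (0 < i <= m)%N -> face i x = pcirc m.+1 x i mu.
Proof. by move=> ?; rewrite /face ifF ?ifF //; lia. Qed.

Lemma face_linear m i : linear (@face m i).
Proof.
move=> c x y; rewrite /face.
by case: ifP => _; last case: ifP => _; rewrite ?linearP // pcirc_linearl.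
Qed.

HB.instance Definition _ m i := GRing.isLinear.Build k (O m) (O m.+1) *:%R
  (@face m i) (@face_linear m i).

Lemma op_diffE m (x : O m) :
  op_diff x = \sum_(0 <= i < m.+2) (-1) ^+ i *: face i x.
Proof.
rewrite big_ltn // big_nat_recr //= addrA expr0 scale1r face0 face_last.
rewrite /op_diff; congr (_ + _ + _ *: _).
- by rewrite -(pcircE erefl).
- apply: eq_big_nat => i lei; rewrite (pcircE (congr1 predn (addnC m 2))).
  by rewrite face_inner.
- by rewrite /msign (_ : m%:Z + 1 = m.+1)%R //; lia.
- by rewrite -(pcircE erefl).
Qed.

Lemma tau_face0 m (x : O m) : tau O _ (face 0 x) = face m.+1 x.
Proof. by rewrite face0 face_last tau_pcirc //= /tau (cm_tau_mu O). Qed.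

(** With [tau_face0], the cocyclic relations between cofaces and rotation; the
condition [tau mu = mu] makes the two outer cofaces fit in the pattern. *)
Lemma tau_faceS m i (x : O m) :
  (i <= m)%N -> tau O _ (face i.+1 x) = face i (tau O _ x).
Proof.
rewrite leq_eqVlt => /predU1P[->|lti]; last first.
  rewrite face_inner //; case: i lti => [|i] lti.
    rewrite tau_pcirc1 //; last lia.
    by rewrite face0 /tau (cm_tau_mu O).
  by rewrite tau_pcirc //=; [rewrite face_inner //; lia|lia].
rewrite face_last; case: m x => [|m] x.
  rewrite tau_pcirc1_nullary /tau !(cm_tau_mu O).
  by rewrite -[RHS](congr1 (face 0) (esym (cyc_tau_order (cm_cyc O) x))).
rewrite tau_pcirc1 //; rewrite face_inner ?leqnn //.
by rewrite /tau (cm_tau_mu O).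
Qed.

Lemma tauV_face m i (x : O m) :
  (i <= m)%N -> tauV (face i x) = face i.+1 (tauV x).
Proof.
by move=> lei; apply: (can_inj (@tauK _ O _)); rewrite tauVK tau_faceS // tauVK.
Qed.

Lemma tauV_face_last m (x : O m) : tauV (face m.+1 x) = face 0 x.
Proof. by rewrite -tau_face0 tauK. Qed.

Lemma codegen_face0 m (x : O m) : codegen 0 (face 0 x) = x.
Proof.
rewrite codegenE face0 -(@pcircC _ _ _ _ _ 1%N _ _ _ _ _ _ _ 1%N) //.
rewrite -(pcircE (erefl : (2 + 0).-1 = 1)%N) /= (mult_mu1l (cm_mult O)).
exact: pcirc_idl.
Qed.

Lemma codegen_face1 m (x : O m.+1) : codegen 0 (face 1 x) = x.
Proof.
rewrite codegenE face_inner // (@pcircA _ _ _ _ _ _ 1%N _ _ _ _ _ _ 1%N) ?addn2 ?addn0 //.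
rewrite -(pcircE (erefl : (2 + 0).-1 = 1)%N) /= (mult_mu1l (cm_mult O)).
by rewrite pcirc_idr.
Qed.

Lemma codegen_face m i (x : O m.+1) : (0 < i <= m.+1)%N ->
  codegen 0 (face i.+1 x) = face i (codegen 0 x).
Proof.
move=> lei; rewrite !codegenE; have [->|nei] := eqVneq i m.+1.
  by rewrite !face_last (@pcircA _ _ _ _ _ _ m _ _ _ _ _ _ 1%N) //; lia.
rewrite !face_inner; try lia.
by rewrite -(@pcircC _ _ _ _ _ m _ _ _ _ _ _ _ i) //; lia.
Qed.

(** The extra degeneracy is the conjugate of [sigma_0] by the rotation, which
reduces its relations with the cofaces to those of [sigma_0]. *)
Lemma extra_degenE m (y : O m.+1) : extra_degen y = tau O _ (codegen 0 (tauV y)).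
Proof.
by rewrite /extra_degen !codegenE /= tau_pcirc1_nullary tauVK.
Qed.

Lemma extra_degen_face0 m (f : O m.+1) : extra_degen (face 0 f) = f.
Proof. by rewrite extra_degenE tauV_face // codegen_face1 tauVK. Qed.

Lemma extra_degen_face_last m (f : O m.+1) :
  extra_degen (face m.+2 f) = tau O _ f.
Proof. by rewrite extra_degenE tauV_face_last codegen_face0. Qed.

Lemma extra_degen_faceS m i (f : O m.+1) : (i <= m)%N ->
  extra_degen (face i.+1 f) = face i (extra_degen f).
Proof.
move=> lei; rewrite !extra_degenE tauV_face //=.
by rewrite codegen_face // tau_faceS.
Qed.

HB.instance Definition _ m := GRing.isLinear.Build k (O m.+1) (O m) *:%R
  (@extra_degen k O m.+1 : O m.+1 -> O m)
  (fun c x y => linearP (codegen m \o tau O m.+1 : {linear O m.+1 -> O m}) c x y).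

(** * Rotated extra degeneracies *)

Lemma iter_tauV_linear n j : linear (iter j (@tauV k O n)).
Proof. by elim: j => [|j IHj] c x y //=; rewrite IHj linearP. Qed.

HB.instance Definition _ n j := GRing.isLinear.Build k (O n) (O n) *:%R
  (iter j (@tauV k O n)) (@iter_tauV_linear n j).

Lemma tauV_pcirc m n p (f : O m) i (g : O n) :
    (0 < i < m)%N -> (m + n = p.+1)%N ->
  tauV (pcirc p f i g) = pcirc p (tauV f) i.+1 g.
Proof.
move=> lei E; apply: (can_inj (@tauK _ O _)).
by rewrite tauVK tau_pcirc //= ?tauVK //; lia.
Qed.

Lemma iter_tauV_pcirc m n p (f : O m) i j (g : O n) :
    (0 < i)%N -> (i + j <= m)%N -> (m + n = p.+1)%N ->
  iter j (@tauV _ O _) (pcirc p f i g) = pcirc p (iter j (@tauV _ O _) f) (i + j) g.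
Proof.
move=> i_gt0 + E; elim: j => [|j IHj] lej; first by rewrite addn0.
by rewrite iterS IHj ?tauV_pcirc ?addnS //; lia.
Qed.

Lemma iter_tauV_face m i j (x : O m) : (i + j <= m.+1)%N ->
  iter j (@tauV _ O _) (face i x) = face (i + j) (iter j (@tauV _ O _) x).
Proof.
elim: j => [|j IHj] lej; first by rewrite addn0.
by rewrite iterS IHj ?tauV_face ?addnS //; lia.
Qed.

(** Rotating [face i] upwards, the coface gets past the last index, where one
rotation turns it into [face 0] without acting on [x]: hence one rotation less on
the right. *)
Lemma iter_tauV_face_wrap m i j (x : O m) : (i <= m.+1 <= i + j)%N -> (j <= m.+1)%N ->
  iter j.+1 (@tauV _ O _) (face i x)
  = face (i + j - m.+1) (iter j (@tauV _ O _) x).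
Proof.
move=> lei lej.
have -> : (j.+1 = (i + j - m.+1) + (m.+1 - i).+1)%N by lia.
rewrite iterD iterS iter_tauV_face; last lia.
rewrite subnKC ?tauV_face_last ?iter_tauV_face; [|lia|lia].
by rewrite -iterD; congr (face _ (iter _ _ _)); lia.
Qed.

(** These elements are [f] with the unit in leg 0 and the output at another leg:
after [j + 1] inverse rotations, leg 0 has become leg [j + 1]. *)
Lemma iter_tauV_extra_degen m j (f : O m.+1) : (j <= m)%N ->
  iter j.+1 (@tauV _ O _) (extra_degen f) = codegen j (iter j.+1 (@tauV _ O _) f).
Proof.
move=> lej; rewrite iterSr extra_degenE tauK !codegenE iter_tauV_pcirc ?addn0 //.
by rewrite -iterSr.
Qed.

(** * Truncated Connes operators *)

(** The sum defining the Connes operator, truncated and written with inverse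
rotations; see [op_connesE]. *)
Definition partial_connes m q (f : O m) : O m.-1 :=
  \sum_(1 <= j < q.+1)
    (-1) ^+ (j * m.-1) *: iter j (@tauV _ O _) (extra_degen f).

Lemma partial_connes0 m (f : O m) : partial_connes 0 f = 0.
Proof. by rewrite /partial_connes big_geq. Qed.

Lemma partial_connesS m q (f : O m) :
  partial_connes q.+1 f = partial_connes q f
    + (-1) ^+ (q.+1 * m.-1) *: iter q.+1 (@tauV _ O _) (extra_degen f).
Proof. by rewrite /partial_connes big_nat_recr. Qed.

(** The cut of the differential at [q]: a partial composition [x o_q g] separates
the cofaces of [x] below slot [q] from those above it. *)
Definition lower_faces m q (x : O m) : O m.+1 :=
  \sum_(0 <= i < q) (-1) ^+ i *: face i x.

Definition upper_faces m q (x : O m) : O m.+1 :=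
  \sum_(q <= i < m.+2) (-1) ^+ i *: face i x.

Lemma sum_face_linear m a b : linear (fun x : O m => \sum_(a <= i < b) (-1) ^+ i *: face i x).
Proof.
move=> c x y; rewrite scaler_sumr -big_split; apply: eq_bigr => i _ /=.
by rewrite linearP scalerDr !scalerA mulrC.
Qed.

HB.instance Definition _ m q := GRing.isLinear.Build k (O m) (O m.+1) *:%R
  (@lower_faces m q) (@sum_face_linear m 0%N q).
HB.instance Definition _ m q := GRing.isLinear.Build k (O m) (O m.+1) *:%R
  (@upper_faces m q) (@sum_face_linear m q m.+2).

Lemma lower_upper_faces m q (x : O m) : (q <= m.+2)%N ->
  lower_faces q x + upper_faces q x = op_diff x.
Proof. by move=> leq; rewrite op_diffE [RHS](@big_cat_nat _ _ _ q). Qed.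

(** The two outer cofaces give [f] and [tau f], and the extra degeneracy shifts
the others. *)
Lemma extra_degen_diff m (f : O m.+1) :
  extra_degen (op_diff f)
  = f + (-1) ^+ m *: tau O _ f
    - \sum_(0 <= i < m.+1) (-1) ^+ i *: face i (extra_degen f).
Proof.
rewrite op_diffE linear_sum big_ltn // big_nat_recr //= big_add1 /=.
rewrite !linearZ /= expr0 scale1r extra_degen_face0 extra_degen_face_last.
rewrite -[RHS]addrA [X in _ = _ + X]addrC; congr (_ + _).
rewrite -sumrN !exprS !mulN1r opprK; congr (_ + _).
apply: eq_big_nat => i lei; rewrite linearZ /= extra_degen_faceS; last lia.
by rewrite exprS mulN1r scaleNr.
Qed.

(** Rotating the preceding formula, the cofaces [i + j.+1 <= m.+1] stay in
increasing order and become the upper cofaces of [x_(j+1)], while the others wrap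
around and become the lower cofaces of [x_j]. *)
Lemma iter_tauV_extra_degen_diff m j (f : O m.+1) : (j <= m)%N ->
  iter j.+1 (@tauV _ O _) (extra_degen (op_diff f))
  = iter j.+1 (@tauV _ O _) f + (-1) ^+ m *: iter j (@tauV _ O _) f
    + (-1) ^+ j *: upper_faces j.+1 (iter j.+1 (@tauV _ O _) (extra_degen f))
    + (-1) ^+ (m + j) *: lower_faces j (iter j (@tauV _ O _) (extra_degen f)).
Proof.
move=> lej; rewrite extra_degen_diff linearB linearD linearZ /= -!addrA.
congr (_ + (_ *: _ + _)); first by rewrite -iterS iterSr tauK.
rewrite -iterS linear_sum (@big_cat_nat _ _ _ (m.+1 - j)) ?leq_subr //.
rewrite opprD -!sumrN !scaler_sumr; congr (_ + _).
  rewrite -[j.+1]add0n big_addn; have -> : (m.+2 - (0 + j.+1) = m.+1 - j)%N by lia.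
  apply: eq_big_nat => i lei; rewrite linearZ add0n [LHS]/= -iterS iter_tauV_face; last lia.
  rewrite scalerA -scaleNr; congr (_ *: _).
  by rewrite -exprD -mulN1r -exprS -signr_odd -[RHS]signr_odd; congr (_ ^+ _); lia.
rewrite -[(m.+1 - j)%N in LHS]add0n big_addn; have -> : (m.+1 - (m.+1 - j) = j)%N by lia.
apply: eq_big_nat => i lei; rewrite linearZ [LHS]/= -iterS iter_tauV_face_wrap; try lia.
rewrite scalerA -scaleNr; congr (_ *: face _ _); last lia.
by rewrite -exprD -mulN1r -exprS -signr_odd -[RHS]signr_odd; congr (_ ^+ _); lia.
Qed.

(** The truncation of [Bd + dB = 0] at [q].  From [q] to [q + 1], the left-hand
side gains [x_(q+1)] evaluated on [df], the lower cofaces of [x_q] and the upper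
cofaces of [x_(q+1)]: the last two cancel against the first by
[iter_tauV_extra_degen_diff], and what remains telescopes. *)
Lemma partial_connes_homotopy m q (f : O m.+1) : (q <= m.+1)%N ->
  partial_connes q (op_diff f)
    + lower_faces q (partial_connes q.-1 f) + upper_faces q (partial_connes q f)
  = (-1) ^+ (q * m.+1) *: iter q (@tauV _ O _) f - f.
Proof.
elim: q => [|q IHq] leq.
  rewrite mul0n scale1r subrr !partial_connes0 !linear0.
  by rewrite !addr0.
have {IHq}IH := IHq (ltnW leq).
pose x j := iter j (@tauV _ O _) (extra_degen f).
(* moving the cut from [q] to [q + 1] does not change the sum of both parts *)
have lowerS : lower_faces q.+1 (partial_connes q f)
    + upper_faces q.+1 (partial_connes q f)
  = lower_faces q (partial_connes q.-1 f) + upper_faces q (partial_connes q f)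
    + (-1) ^+ (q * m) *: lower_faces q (x q).
  rewrite !lower_upper_faces; try lia.
  rewrite -(@lower_upper_faces _ q (partial_connes q f)); last lia.
  rewrite addrAC; congr (_ + _).
  case: q {leq IH} => [|q]; first by rewrite /lower_faces !big_geq // scaler0 addr0.
  by rewrite -linearZ -linearD -[q.+1.-1]/q partial_connesS.
rewrite [q.+1.-1]/= (partial_connesS q (op_diff f)) [X in upper_faces _ X]partial_connesS.
rewrite (linearD (upper_faces _)) (linearZZ (upper_faces _)) /=.
rewrite -!iterS -/(x q.+1).
rewrite [iter _ _ (extra_degen (op_diff f))]iter_tauV_extra_degen_diff //.
rewrite -/(x q.+1) -/(x q).
rewrite -!addrA (addrA (lower_faces _ _)) lowerS.
rewrite (_ : (-1) ^+ (q.+1 * m.+1) *: iter q.+1 (@tauV _ O _) f - f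
   = (-1) ^+ (q.+1 * m.+1) *: iter q.+1 (@tauV _ O _) f
     - (-1) ^+ (q * m.+1) *: iter q (@tauV _ O _) f
     + ((-1) ^+ (q * m.+1) *: iter q (@tauV _ O _) f - f)); last first.
  by rewrite addrA subrK.
rewrite -IH !scalerDr !scalerA -!exprD.
rewrite (@sign_opp _ (q.+1 * m.+1 + m) (q * m.+1)); last by parity.
rewrite (@sign_opp _ (q.+1 * m.+1 + q) (q.+1 * m)); last by parity.
rewrite (@sign_opp _ (q.+1 * m.+1 + (m + q)) (q * m)); last by parity.
rewrite !scaleNr -opprD -[X in _ + (_ + X)]addrA [X in _ + (_ + (_ + X))]addrC.
by rewrite [in LHS](addrA (_ *: iter _ _ _)) addrACA addNr addr0 addrCA !addrA.
Qed.

Lemma iter_tau_tauV n a b (f : O n) : (a + b = n.+1)%N ->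
  iter a (tau O n) f = iter b (@tauV _ O n) f.
Proof.
move=> eqab; have tauVbK : iter b (tau O n) (iter b (@tauV _ O n) f) = f.
  by elim: b {eqab} => //= b IHb; rewrite -iterS iterSr tauVK.
by rewrite -[in LHS]tauVbK -iterD eqab tau_order.
Qed.

(** As [tau] has order [m + 1] on [O m], its powers [0, ..., m] are the inverse
powers [m + 1, ..., 1]. *)
Lemma op_connesE m (f : O m.+1) : op_connes f = partial_connes m.+1 f.
Proof.
rewrite /op_connes /partial_connes big_nat_rev big_add1.
apply: eq_big_nat => i lei; rewrite add0n subSS; congr (_ *: _).
  apply: msignE; have -> : (m - i)%N%:Z = m%:Z - i%:Z by lia.
  have -> : m.+1%:Z - 1 = m by lia.
  by zparity.
by apply: iter_tau_tauV; lia.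
Qed.

(** * The differential of a partial composition *)

Lemma face_pcirc_lt m n N (x : O m) (g : O n) i p : (m + n = N.+1)%N -> (i < p <= m)%N ->
  face i (pcirc N x p g) = pcirc N.+1 (face i x) p.+1 g.
Proof.
move=> eN lei; case: i lei => [|i] lei.
  by rewrite !face0 -(@pcircA _ _ _ _ _ m.+1 _ _ _ _ _ _ p.+1) //; lia.
rewrite !face_inner; try lia.
by rewrite -(@pcircC _ _ _ _ _ m.+1 _ _ x mu g i.+1 p p.+1) //; lia.
Qed.

Lemma face_pcirc_in m n N (x : O m) (g : O n) i p : (m + n = N.+1)%N ->
  (0 < p <= m)%N -> (0 < i <= n)%N ->
  face (p + i.-1) (pcirc N x p g) = pcirc N.+1 x p (face i g).
Proof.
move=> eN lep lei; rewrite !face_inner; try lia.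
by rewrite (@pcircA _ _ _ _ _ _ n.+1 _ _ _ _ _ _ i) //; lia.
Qed.

Lemma face_pcirc_gt m n N (x : O m) (g : O n) i p : (m + n = N.+1)%N ->
  (0 < p < i)%N -> (i <= m.+1)%N ->
  face (i.-1 + n) (pcirc N x p g) = pcirc N.+1 (face i x) p g.
Proof.
move=> eN lep lei; have [->|nei] := eqVneq i m.+1.
  rewrite [(_ + _)%N]eN !face_last.
  by rewrite -(@pcircA _ _ _ _ _ m.+1 _ _ _ _ _ _ p) //; lia.
rewrite !face_inner; try lia.
by rewrite (@pcircC _ _ _ _ _ _ m.+1 _ _ _ _ _ i) //; lia.
Qed.

(** Inside [x], the outer cofaces of [g] attach [mu] to slot [p] of [x].  So
[x o_p dg] contains two terms with [face p x] that are no cofaces of the composite;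
adding them back completes the two sums of [op_diff_pcirc]. *)
Lemma pcirc_face0 m n N (x : O m) (g : O n) p : (m + n = N.+1)%N ->
  (0 < p <= m)%N ->
  pcirc N.+1 x p (face 0 g) = pcirc N.+1 (face p x) p.+1 g.
Proof.
move=> eN lep; rewrite (face_inner _ lep) face0.
by rewrite -(@pcircA _ _ _ _ _ m.+1 _ _ _ _ _ _ p.+1) //; lia.
Qed.

Lemma pcirc_face_last m n N (x : O m) (g : O n) p : (m + n = N.+1)%N ->
  (0 < p <= m)%N ->
  pcirc N.+1 x p (face n.+1 g) = pcirc N.+1 (face p x) p g.
Proof.
move=> eN lep; rewrite (face_inner _ lep) face_last.
by rewrite -(@pcircA _ _ _ _ _ m.+1 _ _ _ _ _ _ p) //; lia.
Qed.

Lemma op_diff_pcirc m n N (x : O m) (g : O n) p :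
    (m + n = N.+1)%N -> (0 < p <= m)%N ->
  op_diff (pcirc N x p g)
  = (-1) ^+ p.+1 *: pcirc N.+1 x p (op_diff g)
    + pcirc N.+1 (lower_faces p.+1 x) p.+1 g
    + (-1) ^+ n.+1 *: pcirc N.+1 (upper_faces p x) p g.
Proof.
move=> eN lep; rewrite !op_diffE.
rewrite (@big_cat_nat _ _ _ p) //=; last lia.
rewrite (@big_cat_nat _ _ _ (p + n) p) /=; [|lia|lia].
(* the cofaces of the composite below, inside and above the inputs of [g] *)
have lower : \sum_(0 <= i < p) (-1) ^+ i *: face i (pcirc N x p g)
    = pcirc N.+1 (lower_faces p x) p.+1 g.
  rewrite -[RHS]/(pcircl N.+1 p.+1 g _) linear_sum.
  apply: eq_big_nat => i lei.
  by rewrite (face_pcirc_lt _ _ eN) ?[RHS](linearZZ (pcircl _ _ _)) //; lia.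
have inner : \sum_(p <= i < p + n) (-1) ^+ i *: face i (pcirc N x p g)
    = (-1) ^+ p.+1 *: pcirc N.+1 x p (\sum_(1 <= i < n.+1) (-1) ^+ i *: face i g).
  rewrite linear_sum scaler_sumr -{1}[p]add0n big_addn addKn big_add1.
  apply: eq_big_nat => i lei.
  rewrite linearZZ scalerA [RHS]/= -(face_pcirc_in _ _ eN) // [(i + p)%N]addnC.
  by congr (_ *: _); rewrite -exprD; apply: sign_congr; parity.
have upper : \sum_(p + n <= i < N.+2) (-1) ^+ i *: face i (pcirc N x p g)
    = (-1) ^+ n.+1 *: pcirc N.+1 (upper_faces p.+1 x) p g.
  rewrite -[pcirc _ (upper_faces _ _) _ _]/(pcircl N.+1 p g _) linear_sum scaler_sumr.
  rewrite -{1}[(p + n)%N]add0n -{1}[p.+1]add0n !big_addn.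
  have -> : (N.+2 - (p + n) = m.+2 - p.+1)%N by lia.
  apply: eq_big_nat => i lei.
  rewrite (linearZZ (pcircl N.+1 p g)) scalerA.
  rewrite [RHS]/= /pcircl -(face_pcirc_gt _ _ eN) //=; [|lia|lia].
  rewrite addnS /= addnA; congr (_ *: _); rewrite -exprD; apply: sign_congr; parity.
rewrite {}lower {}inner {}upper.
have -> : \sum_(0 <= i < n.+2) (-1) ^+ i *: face i g = face 0 g
    + \sum_(1 <= i < n.+1) (-1) ^+ i *: face i g + (-1) ^+ n.+1 *: face n.+1 g.
  by rewrite big_nat_recr // big_ltn // scale1r.
rewrite !linearD linearZZ /= (pcirc_face0 _ _ eN) // (pcirc_face_last _ _ eN) //.
have -> : pcirc N.+1 (lower_faces p.+1 x) p.+1 g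
    = pcirc N.+1 (lower_faces p x) p.+1 g
      + (-1) ^+ p *: pcirc N.+1 (face p x) p.+1 g.
  by rewrite addrC -pcirc_linearl addrC /lower_faces [in LHS]big_nat_recr.
have -> : pcirc N.+1 (upper_faces p x) p g
    = (-1) ^+ p *: pcirc N.+1 (face p x) p g
      + pcirc N.+1 (upper_faces p.+1 x) p g.
  by rewrite -pcirc_linearl /upper_faces [in LHS]big_ltn //; lia.
rewrite [(-1) ^+ p.+1]exprS mulN1r !scaleNr !scalerDr !scalerA.
rewrite [(-1) ^+ n.+1 * _]mulrC.
rewrite [RHS](AC (3*2*2) (4*((1*5)*2*(3*6)*7))) /=.
by rewrite !addNr add0r addr0.
Qed.

(** * The maps H, Z, cup and the pre-Lie product *)

(** Inverse rotations move slot [p - j + 1] of [f] to slot [p + 1], and the unit then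
fills slot [j <= p], which brings it back to slot [p]. *)
Lemma extra_degen_pcirc m n M (f : O m.+1) (g : O n) p j : M = (m + n)%N ->
  (0 < j <= p)%N -> (p <= m)%N ->
  iter j (@tauV _ O _) (extra_degen (pcirc M f (p - j + 1) g))
  = pcirc M.-1 (iter j (@tauV _ O _) (extra_degen f)) p g.
Proof.
case: j => // j; case: M => [|M] eM lej lep; first by lia.
rewrite !iter_tauV_extra_degen; try lia.
rewrite iter_tauV_pcirc; try lia.
have -> : (p - j.+1 + 1 + j.+1 = p.+1)%N by lia.
rewrite !codegenE /=.
by rewrite -(@pcircC _ _ _ _ _ m _ _ _ _ _ j.+1 p.+1 p) //; lia.
Qed.

Lemma op_HE m n (f : O m.+1) (g : O n) :
  op_H f g = \sum_(1 <= p < m.+1)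
    (-1) ^+ (n.+1 * (p + m)) *: pcirc (m + n).-1 (partial_connes p f) p g.
Proof.
apply: eq_big_nat => p lep; rewrite -[pcirc _ _ _ _]/(pcircl _ p g _).
rewrite linear_sum scaler_sumr; apply: eq_big_nat => j lej.
rewrite linearZZ scalerA [in RHS]/= /pcircl -(@extra_degen_pcirc _ _ (m + n)); try lia.
rewrite -(pcircE erefl) -exprD; congr (_ *: _).
apply: msignE; zparity.
Qed.

(** In [g cup f = (mu o_2 f) o_1 g], the unit put into leg 0 of [mu] leaves the
composite of [f] and [g] along their outputs; seen with a leg of [f] as output,
this is a rotation of [f] with [g] in the slot of its former output. *)
Lemma extra_degen_cup m n (f : O m.+1) (g : O n) j : (0 < j <= m.+1)%N ->
  iter j (@tauV _ O _) (extra_degen (gcast (addnC n m.+1) (op_cup g f)))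
  = pcirc (m + n) (iter j (@tauV _ O _) f) j g.
Proof.
case: j => // j lej.
have -> : gcast (addnC n m.+1) (op_cup g f) = pcirc (m + n).+1 (face 0 f) 1 g.
  rewrite /op_cup (@pcircE _ O n.+1 m.+1 (m + n).+1 (addnC n m.+1)).
  have -> : circ mu 1 g = pcirc n.+1 mu 1 g := @pcircE _ O 2 n n.+1 erefl mu 1 g.
  by rewrite (@pcircC _ _ _ _ _ _ m.+2 _ _ _ _ _ 2) //; lia.
rewrite iterSr (@extra_degenE (m + n)) tauK tauV_pcirc //.
rewrite tauV_face // codegenE -(@pcircC _ _ _ _ _ m.+1 _ _ _ _ _ 1 2 1) //; try lia.
rewrite -codegenE codegen_face1 iter_tauV_pcirc //.
by rewrite -iterSr add1n.
Qed.

Lemma op_ZE m n (f : O m.+1) (g : O n) :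
  op_Z f g = (-1) ^+ (m.+1 * n) *: \sum_(1 <= j < m.+2)
    (-1) ^+ (j * (m + n)) *: pcirc (m + n) (iter j (@tauV _ O _) f) j g.
Proof.
rewrite /op_Z; congr (_ *: _).
apply: eq_big_nat => j lej; rewrite -extra_degen_cup //.
congr (_ *: _); apply: msignE; zparity.
Qed.

Lemma op_ocircE m n (f : O m.+1) (g : O n) :
  op_ocirc f g = \sum_(1 <= q < m.+2)
    (-1) ^+ (n.+1 * (q + m.+1)) *: pcirc (m + n) f q g.
Proof.
rewrite /op_ocirc scaler_sumr; apply: eq_big_nat => q leq.
rewrite -(@pcircE _ O m.+1 n (m + n)%N erefl) scalerA /msign -exprD.
congr (_ *: _); apply: sign_congr; rewrite oddD; zparity.
Qed.

Lemma op_cup_connesE m n (f : O m.+1) (g : O n) :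
  op_cup (op_connes f) g
  = pcirc (m + n) (face m.+1 (partial_connes m.+1 f)) m.+1 g.
Proof.
rewrite /op_cup op_connesE face_last -(@pcircE _ O m.+1 n (m + n)%N erefl).
by rewrite -(@pcircE _ O 2 m m.+1 erefl).
Qed.

(** * The homotopy identity *)

(** The right-hand side of [op_diff_pcirc] for [x = P_p f], in degree [m + n] rather
than [(m + n).-1.+1]; see [op_diff_H]. *)
Definition diff_pcirc_terms m n (f : O m.+1) (g : O n) p : O (m + n)%N :=
  (-1) ^+ p.+1 *: pcirc (m + n) (partial_connes p f) p (op_diff g)
  + pcirc (m + n) (lower_faces p.+1 (partial_connes p f)) p.+1 g
  + (-1) ^+ n.+1 *: pcirc (m + n) (upper_faces p (partial_connes p f)) p g.

(** The first sum stands for [d H(f,g)]: for [m = n = 0], [H(f,g)] would have degree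
-1, and the identity still holds with that sum, then empty. *)
Lemma op_homotopy m n (f : O m.+1) (g : O n) :
  (-1) ^+ m.+1 *: (op_Z f g - op_cup (op_connes f) g : O (m + n)%N) - op_ocirc f g
  = \sum_(1 <= p < m.+1) (-1) ^+ (n.+1 * (p + m)) *: diff_pcirc_terms f g p
    + op_H (op_diff f) g
    + (-1) ^+ m *: \sum_(1 <= p < m.+1) (-1) ^+ (n * (p + m)) *:
        pcirc (m + n) (partial_connes p f) p (op_diff g).
Proof.
rewrite op_ZE op_ocircE op_cup_connesE (@op_HE m.+1 n (op_diff f) g).
pose c q : k := (-1) ^+ (n.+1 * (q + m.+1)).
pose T q (x : O m.+1) := pcircl (m + n) q g x.
pose P q : O m := partial_connes q f.
(* the terms with [op_diff g] cancel *)
have cancel : \sum_(1 <= p < m.+1) (-1) ^+ (n.+1 * (p + m)) *: diff_pcirc_terms f g p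
    + (-1) ^+ m *: \sum_(1 <= p < m.+1) (-1) ^+ (n * (p + m)) *:
        pcirc (m + n) (partial_connes p f) p (op_diff g)
  = \sum_(1 <= p < m.+1) c p.+1 *: T p.+1 (lower_faces p.+1 (P p))
    + \sum_(1 <= p < m.+1) c p *: T p (upper_faces p (P p)).
  rewrite scaler_sumr -!big_split; apply: eq_big_nat => p lep.
  rewrite /diff_pcirc_terms /= !scalerDr !scalerA -!exprD.
  rewrite (@sign_opp _ (_ + p.+1) (m + n * (p + m))); last by parity.
  rewrite -!addrA [LHS]addrC -!addrA scaleNr subrr addr0.
  by congr (_ *: _ + _ *: _); apply: sign_congr; parity.
(* shift to [q = p + 1]; the new term [q = 1] vanishes since [P 0 = 0] *)
have lowerE : \sum_(1 <= p < m.+1) c p.+1 *: T p.+1 (lower_faces p.+1 (P p))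
  = \sum_(1 <= q < m.+2) c q *: T q (lower_faces q (P q.-1)).
  rewrite [RHS]big_ltn // [P 1.-1]partial_connes0 /T !linear0 add0r.
  by rewrite [RHS]big_add1.
(* adding the missing term [q = m + 1] leaves [(Bf) cup g] *)
have upperE : \sum_(1 <= p < m.+1) c p *: T p (upper_faces p (P p))
  = \sum_(1 <= q < m.+2) c q *: T q (upper_faces q (P q))
    - (-1) ^+ m.+1 *: T m.+1 (face m.+1 (P m.+1)).
  rewrite [in RHS]big_nat_recr //=.
  have -> : upper_faces m.+1 (P m.+1) = (-1) ^+ m.+1 *: face m.+1 (P m.+1).
    by rewrite /upper_faces big_nat1.
  rewrite /T linearZZ scalerA /c -exprD.
  by rewrite (@sign_congr _ (_ + _) m.+1) ?addrK //; parity.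
rewrite addrAC {}cancel {}lowerE {}upperE.
rewrite [RHS]addrAC addrA -!big_split /=.
rewrite scalerBr -addrA [X in _ + X]addrC addrA; congr (_ - _).
rewrite !scaler_sumr -sumrB; apply: eq_big_nat => q leq.
have TE x : pcirc (m + n) x q g = pcircl (m + n) q g x by [].
rewrite !TE /T -/(c q) -!scalerDr -!(linearD (pcircl _ q g)) [lower_faces _ _ + _]addrC.
rewrite partial_connes_homotopy; last lia.
rewrite linearB (linearZZ (pcircl _ q g)) scalerBr !scalerA -!exprD.
by congr (_ *: _ - _); apply: sign_congr; parity.
Qed.

Lemma op_diff_linear m : linear (@op_diff k O m).
Proof. by move=> c x y; rewrite !op_diffE sum_face_linear. Qed.

HB.instance Definition _ m := GRing.isLinear.Build k (O m) (O m.+1) *:%R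
  (@op_diff k O m) (@op_diff_linear m).

Lemma op_diff_H m n (f : O m.+1) (g : O n) (eN : (m + n).-1.+1 = (m + n)%N) :
  gcast eN (op_diff (op_H f g))
  = \sum_(1 <= p < m.+1) (-1) ^+ (n.+1 * (p + m)) *: diff_pcirc_terms f g p.
Proof.
rewrite op_HE (linear_sum (op_diff (m := (m + n).-1))) linear_sum.
apply: eq_big_nat => p lep; rewrite (linearZZ (op_diff (m := (m + n).-1))) linearZ /=.
rewrite (op_diff_pcirc _ _ (esym eN)) // !linearD !linearZ /= !pcirc_cast //.
Qed.

(** * Normalized cochains *)

(** Each slot of [x o_p g] is a slot of [g] or a slot of [x] other than [p], so
nothing is asked of slot [p] of [x]: the rotations of a normalized [f] satisfy
this condition, but need not be normalized. *)
Lemma codegen_pcirc_eq0 m n N (x : O m) (g : O n) p :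
    (m + n = N.+1)%N -> (0 < p <= m)%N ->
    (forall i, (0 < i <= m)%N -> i != p -> pcirc m.-1 x i e = 0) ->
    (forall i, (i < n)%N -> codegen i g = 0) ->
  forall j, (j < N)%N -> codegen j (pcirc N x p g) = 0.
Proof.
case: N => // N eN lep x0 g0 j ltj; rewrite codegenE.
have [ltp|lepj] := ltnP j.+1 p.
  rewrite -(@pcircC _ _ _ _ _ m.-1 _ _ _ _ _ j.+1 p p.-1) //; try lia.
  rewrite x0; [|lia|lia].
  exact: pcirc0l.
have [ltpn|lepn] := ltnP j.+1 (p + n).
  case: n g eN g0 ltpn => [|n] g eN g0 ltpn; first by lia.
  rewrite (@pcircA _ _ _ _ _ _ n _ _ _ _ _ _ (j.+1 - p).+1) //; try lia.
  by rewrite -codegenE g0 ?linear0 //; lia.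
rewrite (@pcircC _ _ _ _ _ _ m.-1 _ _ _ _ _ (j.+2 - n)%N) //; try lia.
rewrite x0; [|lia|lia].
exact: pcirc0l.
Qed.

(** Slot [j] of [tau^-j f] is the former output of [f]; the other ones are slots of
[f].  The induction goes back two rotations at once for slot 1, by
[tau_pcirc1_nullary]. *)
Lemma pcirc_tauV_eq0 m (f : O m.+1) :
    (forall i, (i < m.+1)%N -> codegen i f = 0) ->
  forall j i, (j <= m.+1)%N -> (0 < i <= m.+1)%N -> i != j ->
  pcirc m (iter j (@tauV _ O _) f) i e = 0.
Proof.
move=> f0 j; have [b] := ubnP j; elim: b j => // b IHb [|j] ltj i lej lei neij.
  by case: i lei neij => // i lei _; rewrite -codegenE f0.
apply: (can_inj (@tauK _ O _)); rewrite linear0.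
case: i lei neij => [|[|i]] // lei neij.
  case: j ltj lej neij => // j ltj lej _.
  by rewrite tau_pcirc1_nullary !iterS !tauVK IHb //; lia.
rewrite tau_pcirc ?addn0 //= tauVK IHb //; lia.
Qed.

Lemma partial_connes_normalized m (f : O m.+1) q :
    (forall i, (i < m.+1)%N -> codegen i f = 0) -> (q <= m.+1)%N ->
  forall i, (0 < i <= m)%N -> pcirc m.-1 (partial_connes q f) i e = 0.
Proof.
move=> f0 leq i; case: m f f0 leq => [|m] f f0 leq lei; first by lia.
rewrite -[LHS]/(pcircl m i e (partial_connes q f)) linear_sum big_nat big1 // => j lej.
rewrite linearZ /= /pcircl; case: j lej => // j lej.
rewrite iter_tauV_extra_degen ?codegenE; last lia.
have [lti|lej'] := ltnP i j.+1.
  rewrite -(@pcircC _ _ _ _ _ m.+1 _ _ _ _ _ i j.+1 j) //; try lia.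
  rewrite pcirc_tauV_eq0 //; [|lia|lia|lia].
  by rewrite pcirc0l scaler0.
rewrite (@pcircC _ _ _ _ _ _ m.+1 _ _ _ _ _ i.+1) //; try lia.
rewrite pcirc_tauV_eq0 //; [|lia|lia|lia].
by rewrite pcirc0l scaler0.
Qed.

Lemma op_H_normalized m n (f : O m) (g : O n) :
    (forall i, (i < m)%N -> codegen i f = 0) ->
    (forall i, (i < n)%N -> codegen i g = 0) ->
  forall j, (j < (m + n).-2)%N -> codegen j (op_H f g) = 0.
Proof.
move=> f0 g0 j; case: m f f0 => [|m] f f0 ltj.
  by rewrite /op_H big_geq // linear0.
rewrite op_HE linear_sum big_nat big1 // => p lep; rewrite linearZ /=.
rewrite (@codegen_pcirc_eq0 m n) ?scaler0 //; try lia.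
by move=> i lei _; rewrite partial_connes_normalized //; lia.
Qed.

Lemma op_Z_normalized m n (f : O m) (g : O n) :
    (forall i, (i < m)%N -> codegen i f = 0) ->
    (forall i, (i < n)%N -> codegen i g = 0) ->
  forall j, (j < (m + n).-1)%N -> codegen j (op_Z f g) = 0.
Proof.
move=> f0 g0 j; case: m f f0 => [|m] f f0 ltj.
  by rewrite /op_Z big_geq // scaler0 linear0.
rewrite op_ZE linearZ linear_sum /= big_nat big1 ?scaler0 // => p lep.
rewrite linearZ /= (@codegen_pcirc_eq0 m.+1 n) ?scaler0 //.
by move=> i lei nei; rewrite pcirc_tauV_eq0 //; lia.
Qed.

End Cyclic.

(** * Integer degrees *)

Section IntegerDegrees.
Variables (k : comPzRingType) (O : cyclic_mult_operad k).

Lemma ccast_linear i j (e : i = j) : linear (@ccast k O i j e).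
Proof. by case: j / e. Qed.

HB.instance Definition _ i j (e : i = j) :=
  GRing.isLinear.Build k (cochain O i) (cochain O j) *:%R (@ccast k O i j e)
    (@ccast_linear i j e).

Lemma ccast_id i (e : i = i) (x : cochain O i) : ccast e x = x.
Proof. by rewrite (eq_irrelevance e erefl). Qed.

Lemma ccast_comp i j l (e : i = j) (e' : j = l) (x : cochain O i) :
  ccast e' (ccast e x) = ccast (etrans e e') x.
Proof. by case: l / e'. Qed.

Lemma ccast_gcast (a b : nat) i (ea : a = b) (e : b = i :> int) (e' : a = i :> int) (x : O a) :
  ccast e' (x : cochain O a) = ccast e (gcast ea x : cochain O b).
Proof. by case: b / ea e; move=> e; rewrite (eq_irrelevance e e'). Qed.

Lemma to_cochainE (a : nat) i deg (e : a = i :> int) (x : O a) :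
  to_cochain (i := i) deg x = ccast e (x : cochain O a).
Proof. by case: i / e deg => deg /=; rewrite (eq_irrelevance (deg isT) erefl). Qed.

Lemma to_cochain0 (a : nat) i deg : to_cochain (i := i) deg (0 : O a) = 0.
Proof.
case: i deg => [b|b] deg //=.
exact: (linear0 (@ccast _ O a b (deg isT))).

Qed.

Lemma normalized_to_cochain (a : nat) i deg (x : O a) :
  (forall j, (j < a)%N -> codegen j x = 0) -> normalized (to_cochain (i := i) deg x).
Proof.
case: i deg => [b|b] //= deg; move: (deg isT) => E.
have eab : a = b by case: E.
by case: b / eab E {deg} => E; rewrite (ccast_id E).
Qed.

Lemma diff_ccast i j (e : i = j) (x : cochain O i) :
  diff (ccast e x) = ccast (congr1 (fun l => l + 1) e) (diff x).
Proof. by case: j / e. Qed.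

Lemma cup_ccast i j l (e : i = j) (x : cochain O i) (y : cochain O l) :
  cup (ccast e x) y = ccast (congr1 (fun h => h + l) e) (cup x y).
Proof. by case: j / e. Qed.

Lemma Hmap_ccastl i j l (e : i = j) (x : cochain O i) (y : cochain O l) :
  Hmap (ccast e x) y = ccast (congr1 (fun h => h + l - 2) e) (Hmap x y).
Proof. by case: j / e. Qed.

Lemma Hmap_ccastr i j l (e : i = j) (x : cochain O l) (y : cochain O i) :
  Hmap x (ccast e y) = ccast (congr1 (fun h => l + h - 2) e) (Hmap x y).
Proof. by case: j / e. Qed.

Lemma diff0 i : diff (0 : cochain O i) = 0.
Proof. by case: i => [m|m] //; rewrite /diff (linear0 (@op_diff k O m)) to_cochain0. Qed.

Lemma op_H0l m n (g : O n) : op_H (0 : O m) g = 0.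
Proof.
case: m => [|m]; first by rewrite /op_H big_geq.
rewrite op_HE big1 // => p _.
rewrite /partial_connes big1 ?pcirc0l ?scaler0 // => j _.
by rewrite !linear0.
Qed.

Lemma op_H0r m n (f : O m) : op_H f (0 : O n) = 0.
Proof.
case: m f => [|m] f; first by rewrite /op_H big_geq.
by rewrite op_HE big1 // => p _; rewrite linear0 scaler0.
Qed.

Lemma Hmap0l i j (y : cochain O j) : Hmap (0 : cochain O i) y = 0.
Proof.
by case: i j y => [m|m] [n|n] // y; rewrite /Hmap op_H0l to_cochain0.
Qed.

Lemma Hmap0r i j (x : cochain O i) : Hmap x (0 : cochain O j) = 0.
Proof.
by case: i j x => [m|m] [n|n] // x; rewrite /Hmap op_H0r to_cochain0.
Qed.

Lemma op_cup0l m n (g : O n) : op_cup (0 : O m) g = 0.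
Proof.
rewrite /op_cup (_ : circ _ 1 0 = 0).
  exact: (etrans (@pcircE _ O m.+1 n (m + n)%N erefl 0 m.+1 g) (@pcirc0l _ _ _ _ _ _ _)).
exact: (etrans (@pcircE _ O 2 m m.+1 erefl _ 1 0) (linear0 (pcirc m.+1 _ 1))).
Qed.

Lemma cup0l i j (y : cochain O j) : cup (0 : cochain O i) y = 0.
Proof.
by case: i j y => [m|m] [n|n] // y; rewrite /cup op_cup0l to_cochain0.
Qed.

Lemma normalized0 i : normalized (0 : cochain O i).
Proof. by case: i => //= n j _; rewrite linear0. Qed.

Lemma Zmap_normalized m n (f : cochain O m) (g : cochain O n) :
  normalized f -> normalized g -> normalized (Zmap f g).
Proof.
case: m f => m f; case: n g => n g f0 g0; try exact: normalized0.
by apply: normalized_to_cochain; apply: op_Z_normalized.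
Qed.

Lemma Hmap_normalized m n (f : cochain O m) (g : cochain O n) :
  normalized f -> normalized g -> normalized (Hmap f g).
Proof.
case: m f => m f; case: n g => n g f0 g0; try exact: normalized0.
by apply: normalized_to_cochain; apply: op_H_normalized.
Qed.

(** Each map in integer degrees is the corresponding map on [O], up to a cast to
the common degree [m + n - 1], which is nonnegative for positive [m]. *)
Lemma homotopy_succ (m n : nat) (f : O m.+1) (g : O n) :
  msign k m.+1 *: (@Zmap _ O m.+1 n f g
      - ccast (deg_cup_connes m.+1 n)
          (@cup _ O (m.+1%:Z - 1) n (@connes _ O m.+1 f) g))
    - @ocirc _ O m.+1 n f g
  = ccast (deg_diff_H m.+1 n) (diff (@Hmap _ O m.+1 n f g))
    + ccast (deg_H_diffl m.+1 n) (@Hmap _ O (m.+1%:Z + 1) n (@diff _ O m.+1 f) g)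
    + msign k (m.+1%:Z - 1) *:
      ccast (deg_H_diffr m.+1 n) (@Hmap _ O m.+1 (n%:Z + 1) f (@diff _ O n g)).
Proof.
have E0 : (m + n)%N = m.+1%:Z + n%:Z - 1 :> int by lia.
have Em : m = m.+1%:Z - 1 :> int by lia.
have Edm : m.+2 = m.+1%:Z + 1 :> int by lia.
have Edn : n.+1 = n%:Z + 1 :> int by lia.
have EH : (m + n)%N = m.+2%:Z + n%:Z - 2 :> int by lia.
have EHr : (m.+1 + n.+1).-2 = m.+1%:Z + n.+1%:Z - 2 :> int by lia.
have eHr : (m.+1 + n.+1).-2 = (m + n)%N by lia.
have ZE : @Zmap _ O m.+1 n f g = ccast E0 (op_Z f g : cochain O (m + n)%N).
  exact: to_cochainE.
have ocircE : @ocirc _ O m.+1 n f g = ccast E0 (op_ocirc f g : cochain O (m + n)%N).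
  exact: to_cochainE.
have cupE : ccast (deg_cup_connes m.+1 n)
    (@cup _ O (m.+1%:Z - 1) n (@connes _ O m.+1 f) g)
    = ccast E0 (op_cup (op_connes f) g : cochain O (m + n)%N).
  rewrite /connes (to_cochainE _ Em) cup_ccast /cup.
  rewrite (to_cochainE _ (erefl (Posz (m + n)))) !ccast_comp.
  by congr (ccast _ _); apply: eq_irrelevance.
have HlE : ccast (deg_H_diffl m.+1 n)
    (@Hmap _ O (m.+1%:Z + 1) n (@diff _ O m.+1 f) g)
    = ccast E0 (op_H (op_diff f) g : cochain O (m + n)%N).
  rewrite /diff (to_cochainE _ Edm) Hmap_ccastl /Hmap (to_cochainE _ EH) !ccast_comp.
  by congr (ccast _ _); apply: eq_irrelevance.
have HrE : ccast (deg_H_diffr m.+1 n)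
    (@Hmap _ O m.+1 (n%:Z + 1) f (@diff _ O n g))
    = ccast E0 (gcast eHr (op_H f (op_diff g)) : cochain O (m + n)%N).
  rewrite /diff (to_cochainE _ Edn) Hmap_ccastr /Hmap (to_cochainE _ EHr) !ccast_comp.
  exact: ccast_gcast.
have dHE : ccast (deg_diff_H m.+1 n) (diff (@Hmap _ O m.+1 n f g))
    = ccast E0 (\sum_(1 <= p < m.+1)
        (-1) ^+ (n.+1 * (p + m)) *: diff_pcirc_terms f g p : cochain O (m + n)%N).
  (* if [m + n = 0], then [H(f,g)] has degree -1, and the sum is empty *)
  have [emn|mn_gt0] := posnP (m + n).
    have [m0 n0] : m = 0%N /\ n = 0%N by lia.
    subst m n; rewrite big_geq // (linear0 (ccast E0)).
    have -> : diff (@Hmap _ O 1 0 f g) = 0 by [].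
    exact: linear0.
  have EH0 : (m + n).-1 = m.+1%:Z + n%:Z - 2 :> int by lia.
  have edH : (m + n).-1.+1 = (m + n)%N by lia.
  have EdH : (m + n).-1.+1 = (m + n).-1%:Z + 1 :> int by lia.
  rewrite -(op_diff_H f g edH) /Hmap (to_cochainE _ EH0) diff_ccast /diff.
  rewrite (to_cochainE _ EdH) !ccast_comp; exact: ccast_gcast.
rewrite ZE ocircE cupE HlE HrE dHE.
rewrite -!(linearB (ccast E0)) -!(linearZZ (ccast E0)) -(linearB (ccast E0)) -!(linearD (ccast E0)).
congr (ccast _ _).
have HrS : gcast eHr (op_H f (op_diff g)) = \sum_(1 <= p < m.+1)
    (-1) ^+ (n * (p + m)) *: pcirc (m + n) (partial_connes p f) p (op_diff g).
  rewrite op_HE linear_sum; apply: eq_big_nat => p lep.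
  rewrite linearZ /= pcirc_cast; congr (_ *: _); apply: sign_congr; parity.
have -> : msign k (m.+1%:Z - 1) = (-1) ^+ m by apply: msignE; zparity.
by rewrite HrS; exact: op_homotopy.
Qed.

Lemma cup_negr i n (x : cochain O i) (y : cochain O (Negz n)) : cup x y = 0.
Proof. by case: i x. Qed.

Lemma Hmap_negr i n (x : cochain O i) (y : cochain O (Negz n)) : Hmap x y = 0.
Proof. by case: i x. Qed.

(** Here [df] has degree 1, and the sum defining [H] is empty. *)
Lemma Hmap_diff_deg0 n (f : O 0) (g : O n) :
  @Hmap _ O (0%Z + 1) n (@diff _ O 0 f) g = 0.
Proof.
move: (@diff _ O 0 f) => h; rewrite -[LHS]/(@Hmap _ O (Posz 1) n h g).
by rewrite /Hmap /op_H big_geq // to_cochain0.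
Qed.

(** If [m <= 0] or [n < 0], every term vanishes. *)
Lemma homotopy m n (f : cochain O m) (g : cochain O n) :
  msign k m *: (Zmap f g - ccast (deg_cup_connes m n) (cup (connes f) g))
  - ocirc f g
  = ccast (deg_diff_H m n) (diff (Hmap f g))
    + ccast (deg_H_diffl m n) (Hmap (diff f) g)
    + msign k (m - 1) *: ccast (deg_H_diffr m n) (Hmap f (diff g)).
Proof.
case: n g => [n|n] g; last first.
  have -> : Zmap f g = 0 by case: m f.
  have -> : ocirc f g = 0 by case: m f.
  rewrite cup_negr !Hmap_negr diff0 [diff g]/(0) Hmap0r !linear0.
  by rewrite !(subr0, scaler0, addr0).
case: m f => [[|m]|m] f; first 1 last.
- exact: homotopy_succ.
- rewrite [Zmap f g]/(0) [ocirc f g]/(0) [connes f]/(0) [diff f]/(0) [Hmap f g]/(0).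
  rewrite [Hmap f _]/(0) cup0l Hmap0l diff0 !linear0.
  by rewrite !(subr0, scaler0, addr0).
have -> : Zmap f g = 0.
  by rewrite /Zmap /op_Z big_geq // scaler0 to_cochain0.
have -> : ocirc f g = 0.
  by rewrite /ocirc /op_ocirc big_geq // scaler0 to_cochain0.
have -> : connes f = 0 by [].
have H0 j (y : cochain O j) : @Hmap _ O (Posz 0) j f y = 0.
  by case: j y => // j y; rewrite /Hmap /op_H big_geq // to_cochain0.
rewrite cup0l !H0 Hmap_diff_deg0 diff0 !linear0.
by rewrite !(subr0, scaler0, addr0).
Qed.

End IntegerDegrees.

Theorem proposition1p6 (k : comPzRingType) (O : cyclic_mult_operad k)
  (m n : int) (f : cochain O m) (g : cochain O n)
  (hf : normalized f) (hg : normalized g) :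
  [/\ normalized (Zmap f g),
      normalized (Hmap f g)
    & msign k m *: (Zmap f g - ccast (deg_cup_connes m n) (cup (connes f) g))
      - ocirc f g
      = ccast (deg_diff_H m n) (diff (Hmap f g))
        + ccast (deg_H_diffl m n) (Hmap (diff f) g)
        + msign k (m - 1) *: ccast (deg_H_diffr m n) (Hmap f (diff g))].
Proof.
split; [exact: Zmap_normalized|exact: Hmap_normalized|].
exact: homotopy.
Qed.
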